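(* Let $B \subseteq A$ be a (unital) inclusion of multimatrix algebras over $\mathbb{C}$. Then the inclusion $B \subseteq A$ is of depth $2$ if and only if $B$ is normal in $A$.
   Context: A multimatrix algebra is a finite direct product of full matrix algebras over $\mathbb{C}$ (equivalently, a finite-dimensional semisimple $\mathbb{C}$-algebra). For an inclusion $B \subseteq A$ of multimatrix algebras let $V_1,\dots,V_s$ be the simple $A$-modules and $W_1,\dots,W_r$ the simple $B$-modules up to isomorphism; the inclusion matrix is the $r\times s$ matrix $M=(m_{ij})$, where $m_{ij}$ is the multiplicity of $W_i$ in the restriction $V_j\!\downarrow_B$. Powers of $M$ are understood as $M^1=M$, $M^2=MM^t$, $M^3=MM^tM$, $M^4=MM^tMM^t$, etc. Inequalities between matrices are entrywise. $M$ satisfies a depth $n$ inequality ($n\ge 2$) if $M^{n+1}\le qM^{n-1}$ for some positive integer $q$; the depth of the inclusion is the least $n\geq 2$ for which a depth $n$ inequality holds. The subalgebra $B$ is normal in $A$ (in the sense of Rieffel) if for every maximal two-sided ideal $I$ of $A$ one has $(I\cap B)A=A(I\cap B)$ as subsets of $A$. *)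

(* Defs.v *)
From HB Require Import structures.
From mathcomp Require Import all_boot all_order all_algebra all_field.

Set Implicit Arguments.
Unset Strict Implicit.
Unset Printing Implicit Defensive.

Import GRing.Theory.
Local Open Scope ring_scope.

(* The joint map a |-> (phi_i a)_i is an isomorphism of K-algebras from A onto
   the product of the full matrix algebras of sizes d_i + 1 >= 1. *)
Definition multimatrix (K : fieldType) (A : falgType K) : Prop :=
  exists (n : nat) (d : 'I_n -> nat)
         (phi : forall i, {lrmorphism A -> 'M[K]_((d i).+1)}),
    bijective (fun a : A =>
      [ffun i => phi i a] : {dffun forall i : 'I_n, 'M[K]_((d i).+1)}).

Section Modules.
Variable A : pzRingType.

Definition isomorphic (U V : lmodType A) : Prop :=
  exists f : {linear U -> V}, bijective f.

Definition simple_module (V : lmodType A) : Prop :=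
  (exists v : V, v != 0) /\
  forall S : {pred V}, GRing.submod_closed S ->
    (forall v, v \in S -> v = 0) \/ (forall v, v \in S).

(* V_0, ..., V_(s-1) lists the simple A-modules, once each up to isomorphism. *)
Definition simple_modules (s : nat) (V : 'I_s -> lmodType A) : Prop :=
  [/\ forall j, simple_module (V j),
      forall j k, isomorphic (V j) (V k) -> j = k
    & forall U : lmodType A, simple_module U -> exists j, isomorphic U (V j)].

(* V is isomorphic to the direct sum of m_i copies of W_i for i < r; f i k is
   the inclusion of the k-th copy of W_i. *)
Definition has_multiplicities (r : nat) (W : 'I_r -> lmodType A)
    (m : 'I_r -> nat) (V : lmodType A) : Prop :=
  exists f : forall i, 'I_(m i) -> {linear W i -> V},
    bijective (fun w : {dffun forall i : 'I_r, {ffun 'I_(m i) -> W i}} =>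
      \sum_i \sum_(k < m i) f i k (w i k)).

End Modules.

(* The proof that 1 \in B is an argument because 1 : subvs_of B, which is the
   identity of B, has to act as 1 : A does. *)
Definition restriction (K : fieldType) (A : falgType K) (B : {aspace A})
    (B1 : 1 \in B) (V : lmodType A) : Type := V.

Section Restriction.
Variables (K : fieldType) (A : falgType K) (B : {aspace A}) (B1 : 1 \in B).
Variable V : lmodType A.

HB.instance Definition _ := GRing.Zmodule.on (restriction B1 V).

Definition restriction_scale (b : subvs_of B) (v : restriction B1 V) :
    restriction B1 V :=
  (vsval b : A) *: (v : V).

Fact restriction_scaleA b c v :
  restriction_scale b (restriction_scale c v) = restriction_scale (b * c) v.
Proof. by rewrite /restriction_scale scalerA. Qed.

Fact restriction_scale1 : left_id 1 restriction_scale.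
Proof.
move=> v; rewrite /restriction_scale (_ : vsval 1 = 1) ?scale1r //.
by apply/eqP; rewrite /= algid_eq1.
Qed.

Fact restriction_scaleDr : right_distributive restriction_scale +%R.
Proof. by move=> b u v; rewrite /restriction_scale scalerDr. Qed.

Fact restriction_scaleDl v :
  {morph restriction_scale^~ v : b c / b + c}.
Proof. by move=> b c; rewrite /restriction_scale linearD scalerDl. Qed.

HB.instance Definition _ :=
  GRing.Zmodule_isLmodule.Build (subvs_of B) (restriction B1 V)
    restriction_scaleA restriction_scale1
    restriction_scaleDr restriction_scaleDl.

End Restriction.

(* M i j is the multiplicity of W_i in the restriction of V_j to B. *)
Definition inclusion_matrix (K : fieldType) (A : falgType K) (B : {aspace A})
    (B1 : 1 \in B) (r s : nat) (W : 'I_r -> lmodType (subvs_of B))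
    (V : 'I_s -> lmodType A) (M : 'M[nat]_(r, s)) : Prop :=
  forall j, has_multiplicities W (fun i => M i j) (restriction B1 (V j)).

(* The number of columns of the n-th alternating power below: it is r for
   n even and s for n odd, and width r s n.+2 is convertible to width r s n. *)
Fixpoint width (r s n : nat) : nat :=
  if n is n'.+1 then width s r n' else r.

(* M, M M^T, M M^T M, ... for n = 1, 2, 3, ...  *)
Fixpoint altpow (r s : nat) (M : 'M[nat]_(r, s)) (n : nat) :
    'M[nat]_(r, width r s n) :=
  if n is n'.+1 then M *m altpow M^T n' else 1%:M.

(* M^(n+1) <= q M^(n-1) with n = k + 1. *)
Definition depth_inequality (r s : nat) (M : 'M[nat]_(r, s)) (n : nat) : Prop :=
  if n is k.+1 then
    exists2 q : nat, (0 < q)%N &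
      forall (i : 'I_r) (j : 'I_(width r s k)),
        ((altpow M k.+2 : 'M[nat]_(r, width r s k)) i j
           <= q * altpow M k i j)%N
  else False.

Definition is_depth (r s : nat) (M : 'M[nat]_(r, s)) (n : nat) : Prop :=
  [/\ (2 <= n)%N, depth_inequality M n
    & forall m, (2 <= m)%N -> depth_inequality M m -> (n <= m)%N].

Section Normality.
Variables (K : fieldType) (A : falgType K).

(* As A is a unital K-algebra, its ideals are K-subspaces. *)
Definition two_sided_ideal (I : {vspace A}) : bool :=
  (fullv * I <= I)%VS && (I * fullv <= I)%VS.

Definition maximal_ideal (I : {vspace A}) : Prop :=
  [/\ two_sided_ideal I, I != fullv
    & forall J : {vspace A}, two_sided_ideal J -> (I <= J)%VS ->
        J = I \/ J = fullv].

Definition normal_subalgebra (B : {aspace A}) : Prop :=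
  forall I : {vspace A}, maximal_ideal I ->
    ((I :&: B) * fullv = fullv * (I :&: B))%VS.

End Normality.

(* Main.v *)
(** Each block of A has a unit e_j, a central idempotent acting as 1 on V_j and
    as 0 on the other simple modules; similarly f_i for the blocks of B.
    Then m_ij > 0 iff f_i e_j <> 0, and the maximal ideals of A are the
    I_j = {a | a e_j = 0}.  The depth 2 inequality says that any two columns of
    M have equal or disjoint supports.  The ideal I_j :&: B of B is generated
    by the central idempotent g of B that is the sum of the f_i with m_ij = 0,
    and (I_j :&: B) A = A (I_j :&: B) says that g is central in A, i.e. that
    for every k the support of column k is contained in that of column j or
    disjoint from it. *)

From HB Require Import structures.
Require Import Defs.
From mathcomp Require Import all_boot all_order all_algebra all_field.
From mathcomp Require Import complex reals boolp.

Set Implicit Arguments.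
Unset Strict Implicit.
Unset Printing Implicit Defensive.

Import GRing.Theory.
Local Open Scope ring_scope.

Lemma bijective_inj_surj (T U : Type) (f : T -> U) :
  injective f -> (forall y, exists x, f x = y) -> bijective f.
Proof.
move=> f_inj /choice[g fgK]; exists g => // x.
by apply: f_inj; rewrite fgK.
Qed.

(** An entry of [X] is isolated and moved to any position; dividing by a nonzero entry later shows
    that a matrix block is simple. *)
Lemma delta_mx_mulmx_delta (K : comNzRingType) m n m' n' (X : 'M[K]_(m, n))
    (k : 'I_m') p q (l : 'I_n') :
  delta_mx k p *m X *m delta_mx q l = X p q *: delta_mx k l.
Proof.
rewrite -(mul_delta_mx (0 : 'I_1)) -(mul_delta_mx (0 : 'I_1) q).
rewrite -!mulmxA (mulmxA X) -colE (mulmxA (delta_mx 0 p)) -rowE.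
have -> : row p (col q X) = (X p q)%:M.
  by apply/matrixP => x y; rewrite !ord1 !mxE eqxx.
by rewrite mul_scalar_mx -scalemxAr mul_delta_mx.
Qed.

(** * Modules over a ring and Schur's lemma *)

Section Modules.
Variable A : pzRingType.

Lemma isomorphic_sym (U V : lmodType A) : isomorphic U V -> isomorphic V U.
Proof.
move=> [f [g fK gK]].
have g_lin := can2_linear fK gK.
pose h : {linear V -> U} :=
  HB.pack g (GRing.isLinear.Build A V U *:%R g g_lin).
by exists h; exists f.
Qed.

Lemma isomorphic_trans (U V W : lmodType A) :
  isomorphic U V -> isomorphic V W -> isomorphic U W.
Proof.
by move=> [f f_bij] [g g_bij]; exists (g \o f : {linear _ -> _});
  apply: bij_comp.
Qed.

Lemma isomorphic_scale_eq (U V : lmodType A) (a b : A) :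
  isomorphic U V -> (forall u : U, a *: u = b *: u) ->
  forall v : V, a *: v = b *: v.
Proof.
by move=> [f [g fK gK]] ab v; rewrite -[v]gK -!linearZ /= ab.
Qed.

(** The kernel and the image of [f] are submodules; a nonzero value rules out a full kernel and a
    zero image. *)
Lemma schur (U V : lmodType A) (f : {linear U -> V}) :
  simple_module U -> simple_module V -> (exists u, f u != 0) -> isomorphic U V.
Proof.
move=> [_ simU] [_ simV] [u0 fu0].
exists f; apply: bijective_inj_surj.
- have ker_closed : GRing.submod_closed [pred u | f u == 0].
    split=> [|a u v]; rewrite !inE ?linear0 // => /eqP fu /eqP fv.
    by rewrite linearP fu fv scaler0 addr0.
  have [ker0|kerT] := simU _ ker_closed; last first.
    by rewrite (eqP (kerT u0)) eqxx in fu0.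
  by apply/raddf_inj => u fu; apply: ker0; rewrite inE fu.
- have im_closed : GRing.submod_closed [pred v | `[< exists u, f u = v >]].
    split=> [|a u v]; rewrite !inE.
      by apply/asboolP; exists 0; rewrite linear0.
    move=> /asboolP[x <-] /asboolP[y <-]; apply/asboolP.
    by exists (a *: x + y); rewrite linearP.
  have [im0|imT v] := simV _ im_closed; last by apply/asboolP/imT.
  by case/eqP: fu0; apply: im0; rewrite inE; apply/asboolP; exists u0.
Qed.

End Modules.

(** * Column vectors as a simple module over a matrix block *)

Definition column_module (K : fieldType) (A : falgType K) (d : nat)
  (phi : {lrmorphism A -> 'M[K]_d.+1}) : Type := 'cV[K]_d.+1.

Section ColumnModule.
Variables (K : fieldType) (A : falgType K) (d : nat).
Variable phi : {lrmorphism A -> 'M[K]_d.+1}.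

HB.instance Definition _ := GRing.Zmodule.on (column_module phi).

Definition column_scale (a : A) (v : column_module phi) : column_module phi :=
  phi a *m (v : 'cV[K]_d.+1).

Fact column_scaleA a b v :
  column_scale a (column_scale b v) = column_scale (a * b) v.
Proof. by rewrite /column_scale rmorphM mulmxA. Qed.

Fact column_scale1 : left_id 1 column_scale.
Proof. by move=> v; rewrite /column_scale rmorph1 mul1mx. Qed.

Fact column_scaleDr : right_distributive column_scale +%R.
Proof. by move=> a u v; rewrite /column_scale mulmxDr. Qed.

Fact column_scaleDl v : {morph column_scale^~ v : a b / a + b}.
Proof. by move=> a b; rewrite /column_scale rmorphD mulmxDl. Qed.

HB.instance Definition _ :=
  GRing.Zmodule_isLmodule.Build A (column_module phi)
    column_scaleA column_scale1 column_scaleDr column_scaleDl.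

Lemma column_scaleE (a : A) (v : column_module phi) :
  a *: v = phi a *m (v : 'cV_d.+1).
Proof. by []. Qed.

Lemma simple_column_module :
  (forall X, exists a, phi a = X) -> simple_module (column_module phi).
Proof.
move=> phi_surj; split.
  exists (delta_mx 0 0 : 'cV[K]_d.+1); apply/eqP => /matrixP/(_ 0 0)/eqP.
  by rewrite !mxE oner_eq0.
move=> S [S0 Slin].
have [[v Sv v0]|Snz] := pselect (exists2 v, v \in S & v != 0); last first.
  left=> v Sv; apply/eqP/negPn/negP => v0; by apply: Snz; exists v.
right=> w; have /cV0Pn[p vp] := v0.
(* [phi a] reads off the nonzero coordinate [p] of [v], rescales it to 1 and outputs [w]. *)
have [a phia] := phi_surj ((v p 0)^-1 *: ((w : 'cV_d.+1) *m delta_mx 0 p)).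
suff -> : w = a *: v + 0 by apply: Slin.
rewrite addr0 column_scaleE phia -scalemxAl -mulmxA.
rewrite -rowE.
have -> : row p v = (v p 0)%:M by apply/matrixP => i j; rewrite !ord1 !mxE eqxx.
by rewrite mul_mx_scalar scalerA mulVf ?scale1r.
Qed.

End ColumnModule.

(* [e j] is the unit of the block of [A] that acts faithfully on [U j]. *)
Record block_units (K : fieldType) (A : falgType K) (t : nat)
    (U : 'I_t -> lmodType A) (e : 'I_t -> A) : Prop := BlockUnits {
  block_unit_scale : forall j k (u : U k), e j *: u = if j == k then u else 0;
  joint_faithful : forall a b : A,
    (forall j (u : U j), a *: u = b *: u) -> a = b;
  block_unit_span : forall j (a : A), a * e j != 0 ->
    exists m (x y : 'I_m -> A), e j = \sum_k x k * a * y k }.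

(** * Block units from the factors of a multimatrix algebra *)

Section MatrixUnits.
Variables (K : fieldType) (A : falgType K) (n : nat) (d : 'I_n -> nat).
Variable phi : forall i, {lrmorphism A -> 'M[K]_((d i).+1)}.
Variable psi : forall i, 'M[K]_((d i).+1) -> A.
Arguments psi : clear implicits.
Hypothesis phi_inj : forall a b, (forall i, phi i a = phi i b) -> a = b.
Hypothesis phi_psi : forall i X, phi i (psi i X) = X.
Hypothesis phi_psi_neq : forall i k (X : 'M_((d i).+1)),
  k != i -> phi k (psi i X) = 0.

(** Joint injectivity determines an element by its components. As [psi] is a bare family of
    functions, its algebraic rules come from such comparisons. *)
Lemma psiE i (a : A) X :
  phi i a = X -> (forall k, k != i -> phi k a = 0) -> a = psi i X.
Proof.
move=> aX a0; apply: phi_inj => k; have [->|ki] := eqVneq k i.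
  by rewrite phi_psi aX.
by rewrite phi_psi_neq // a0.
Qed.

Lemma mul_psi i (a : A) (X : 'M_((d i).+1)) :
  a * psi i X = psi i (phi i a *m X).
Proof.
apply: psiE => [|k ki]; rewrite rmorphM /= ?phi_psi //.
by rewrite phi_psi_neq // mulr0.
Qed.

Lemma psi_mul i (a : A) (X : 'M_((d i).+1)) :
  psi i X * a = psi i (X *m phi i a).
Proof.
apply: psiE => [|k ki]; rewrite rmorphM /= ?phi_psi //.
by rewrite phi_psi_neq // mul0r.
Qed.

Lemma psi0 i : psi i 0 = 0.
Proof. by apply/esym/psiE => [|k _]; rewrite rmorph0. Qed.

Lemma psi_sum i (I : finType) (F : I -> 'M_((d i).+1)) :
  psi i (\sum_k F k) = \sum_k psi i (F k).
Proof.
apply/esym/psiE => [|k ki]; rewrite raddf_sum /=.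
  by apply: eq_bigr => k _; rewrite phi_psi.
by apply: big1 => x _; rewrite phi_psi_neq.
Qed.

Lemma psiD i (X Y : 'M_((d i).+1)) : psi i (X + Y) = psi i X + psi i Y.
Proof.
by apply/esym/psiE => [|k ki]; rewrite raddfD /= ?phi_psi //
  !phi_psi_neq ?addr0.
Qed.

Lemma sum_psi1 : \sum_i psi i 1 = 1.
Proof.
apply: phi_inj => k; rewrite rmorph1 raddf_sum /= (bigD1 k) //= phi_psi.
by rewrite big1 ?addr0 // => i ik; rewrite phi_psi_neq // eq_sym.
Qed.

Lemma psi1_central i a : a * psi i 1 = psi i 1 * a.
Proof. by rewrite mul_psi psi_mul mulmx1 mul1mx. Qed.

(** The central idempotents [psi i 1] sum to 1, so one of them does not kill [u0]. Its fixed vectors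
    form a submodule by centrality, and this contains the nonzero vector [psi i 1 *: u0]. *)
Lemma simple_module_block (U : lmodType A) : simple_module U ->
  exists i, forall u : U, psi i 1 *: u = u.
Proof.
move=> [[u0 u0nz] simU].
have [i ui] : exists i, psi i 1 *: u0 != 0.
  have [i ui|all0] := pickP (fun i => psi i 1 *: u0 != 0); first by exists i.
  case/eqP: u0nz; rewrite -[u0]scale1r -sum_psi1 scaler_suml big1 // => i _.
  by apply/eqP/negbFE/all0.
exists i; have fix_closed :
    GRing.submod_closed [pred u : U | psi i 1 *: u == u].
  split=> [|a u v]; rewrite !inE ?scaler0 // => /eqP uE /eqP vE.
  by rewrite scalerDr scalerA -psi1_central -scalerA uE vE.
have [fix0|fixT u] := simU _ fix_closed; last by apply/eqP/fixT.
case/eqP: ui; apply: fix0; rewrite inE scalerA mul_psi phi_psi.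
by rewrite mulmx1.
Qed.

Lemma psi_scale_neq i k (X : 'M_((d k).+1)) (U : lmodType A) (u : U) :
  i != k -> (forall u : U, psi i 1 *: u = u) -> psi k X *: u = 0.
Proof.
move=> ik Ui; rewrite -[u]Ui scalerA mul_psi phi_psi_neq // mul0mx psi0.
by rewrite scale0r.
Qed.

Lemma simple_column i : simple_module (column_module (phi i)).
Proof. by apply: simple_column_module => X; exists (psi i X). Qed.

Lemma column_isomorphic i (U : lmodType A) : simple_module U ->
  (forall u : U, psi i 1 *: u = u) ->
  isomorphic (column_module (phi i)) U.
Proof.
move=> simU Ui.
pose E p q : A := psi i (delta_mx p q).
have [u0 u0nz] := simU.1.
have [p Epu] : exists p, E 0 p *: u0 != 0.
  have [p Epu|all0] := pickP (fun p => E 0 p *: u0 != 0); first by exists p.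
  case/eqP: u0nz; rewrite -[u0]Ui.
  (* If every [E 0 p] killed [u0], so would this sum, although it acts as the identity. *)
  have -> : psi i 1 = \sum_p E p 0 * E 0 p.
    rewrite -[1]/(1%:M) mx1_sum_delta psi_sum; apply: eq_bigr => p _.
    by rewrite /E mul_psi phi_psi mul_delta_mx.
  rewrite scaler_suml big1 // => p _; rewrite -scalerA.
  by move/negbFE/eqP: (all0 p) => ->; rewrite scaler0.
(* A column is read as a matrix supported in column 0 and applied to the nonzero vector
   [E 0 p *: u0]. Left multiplication respects this, so Schur's lemma applies. *)
pose f (v : column_module (phi i)) : U :=
  psi i ((v : 'cV_((d i).+1)) *m (delta_mx 0 0 : 'rV_((d i).+1)))
    *: (E 0 p *: u0).
have f_lin : linear f.
  move=> a v w; rewrite /f mulmxDl psiD scalerDl; congr (_ + _).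
  by rewrite [RHS]scalerA mul_psi column_scaleE mulmxA.
pose h : {linear column_module (phi i) -> U} :=
  HB.pack f (GRing.isLinear.Build A (column_module (phi i)) U *:%R f f_lin).
apply: (schur (f := h)) (simple_column i) simU _.
exists (delta_mx 0 0 : 'cV_((d i).+1)); rewrite /= /f mul_delta_mx.
by rewrite scalerA mul_psi phi_psi mul_delta_mx.
Qed.

Lemma exists_block_units_phi (t : nat) (U : 'I_t -> lmodType A) :
  simple_modules U -> exists e, block_units U e.
Proof.
move=> [simU U_inj U_surj].
have /choice[s Us] j := simple_module_block (simU j).
have U_col j : isomorphic (column_module (phi (s j))) (U j).
  exact: column_isomorphic (simU j) (Us j).
(* Two listed modules in the same block are both isomorphic to its column module. *)
have s_inj : injective s.
  move=> j k sjk; apply: U_inj; apply: isomorphic_trans (U_col k).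
  by rewrite -sjk; apply/isomorphic_sym.
exists (fun j => psi (s j) 1); split.
- move=> j k u; case: eqVneq => [->|jk]; first exact: Us.
  by apply: psi_scale_neq (Us k); rewrite (inj_eq s_inj) eq_sym.
- move=> a b ab; apply: phi_inj => i.
  (* Completeness of the list puts every column module among the [U j]; acting on basis columns
     recovers [phi i a]. *)
  have [j /isomorphic_sym Uj] := U_surj _ (simple_column i).
  apply/matrixP => p c.
  have := isomorphic_scale_eq Uj (ab j) (delta_mx c 0 : 'cV_((d i).+1)).
  by rewrite !column_scaleE -!colE => /matrixP/(_ p 0); rewrite !mxE.
- move=> j a; set i := s j; rewrite mul_psi mulmx1 => phia.
  have /matrix0Pn[p [q apq]] : phi i a != 0.
    by apply: contraNneq phia => ->; rewrite psi0.
  (* These factors move entry [(p, q)], scaled to 1, to position [(k, k)]; the sum over [k] is the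
     identity of the block. *)
  exists (d i).+1, (fun k => psi i ((phi i a p q)^-1 *: delta_mx k p)).
  exists (fun k => psi i (delta_mx q k)).
  rewrite -[1]/(1%:M) mx1_sum_delta psi_sum; apply: eq_bigr => k _.
  rewrite psi_mul mul_psi phi_psi -!scalemxAl.
  by rewrite delta_mx_mulmx_delta scalerA mulVf ?scale1r.
Qed.

End MatrixUnits.

Lemma exists_block_units (K : fieldType) (A : falgType K) (t : nat)
    (U : 'I_t -> lmodType A) :
  multimatrix A -> simple_modules U -> exists e, block_units U e.
Proof.
move=> [n [d [phi [g phiK gK]]]] simU.
pose psi i (X : 'M[K]_((d i).+1)) : A :=
  g (finfun (dfwith (fun k => 0 : 'M[K]_((d k).+1)) X)).
have phi_g w i : phi i (g w) = w i.
  by have /ffunP/(_ i) := gK w; rewrite ffunE.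
apply: (@exists_block_units_phi _ _ _ _ phi psi) => //.
- move=> a b ab; apply: (can_inj phiK); apply/ffunP => i.
  by rewrite !ffunE ab.
- by move=> i X; rewrite /psi phi_g ffunE dfwith_in.
- by move=> i k X ki; rewrite /psi phi_g ffunE dfwith_out // eq_sym.
Qed.

Lemma memv_lker_amulr (K : fieldType) (A : falgType K) (a b : A) :
  (a \in lker (amulr b)) = (a * b == 0).
Proof. by rewrite memv_ker lfunE. Qed.

Lemma ideal_eq_fullv (K : fieldType) (A : falgType K) (I : {vspace A}) :
  two_sided_ideal I -> 1 \in I -> I = fullv.
Proof.
move=> /andP[/prodvP IL _] I1; apply/eqP.
rewrite eqEsubv subvf; apply/subvP => a _.
by rewrite -[a]mulr1 IL ?memvf.
Qed.

(** * Central idempotents and maximal ideals *)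

Section BlockUnits.
Variables (K : fieldType) (A : falgType K) (t : nat).
Variables (U : 'I_t -> lmodType A) (e : 'I_t -> A).
Hypotheses (simU : forall j, simple_module (U j)) (eU : block_units U e).

Lemma block_unitC j a : a * e j = e j * a.
Proof.
apply: (joint_faithful eU) => k u; rewrite -!scalerA !(block_unit_scale eU).
by case: eqP; rewrite ?scaler0.
Qed.

Lemma block_unitM j k : e j * e k = if j == k then e k else 0.
Proof.
apply: (joint_faithful eU) => l u; rewrite -scalerA.
have [<-|jk] := eqVneq j k.
  by rewrite !(block_unit_scale eU); case: (j == l).
rewrite scale0r (block_unit_scale eU k); have [kl|_] := eqVneq k l.
  by rewrite (block_unit_scale eU); case: eqP => // jl;
    rewrite jl kl eqxx in jk.
by rewrite scaler0.
Qed.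

Lemma sum_block_units : \sum_j e j = 1.
Proof.
apply: (joint_faithful eU) => k u; rewrite scaler_suml scale1r (bigD1 k) //=.
rewrite (block_unit_scale eU) eqxx big1 ?addr0 // => j jk.
by rewrite (block_unit_scale eU) (negPf jk).
Qed.

(** Joint faithfulness gives this; it identifies [lker (amulr (e j))] with the annihilator of
    [U j]. *)
Lemma mul_block_unit_eq0 j a : a * e j = 0 <-> forall u : U j, a *: u = 0.
Proof.
split=> [ae0 u|aU].
  by rewrite -[u](_ : e j *: u = u) ?scalerA ?ae0 ?scale0r //
    (block_unit_scale eU) eqxx.
apply: (joint_faithful eU) => k u.
rewrite -scalerA (block_unit_scale eU) scale0r.
by case: eqP u => [<- u|_ u]; rewrite ?scaler0.
Qed.

Lemma block_unit_neq0 j : e j != 0.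
Proof.
have [[u u0] _] := simU j; apply: contraNneq u0 => ej0.
by have := block_unit_scale eU j u; rewrite eqxx ej0 scale0r => <-.
Qed.

Lemma eq_block_units a b : (forall j, a * e j = b * e j) -> a = b.
Proof.
move=> ab; rewrite -[a]mulr1 -[b]mulr1 -sum_block_units !mulr_sumr.
exact: eq_bigr.
Qed.

(** Simplicity of the block: an element with a nonzero component in it generates its unit. *)
Lemma block_unit_ideal j a (I : {vspace A}) :
  two_sided_ideal I -> a \in I -> a * e j != 0 -> e j \in I.
Proof.
move=> /andP[/prodvP IL /prodvP IR] Ia /(block_unit_span eU)[m [x [y ->]]].
by apply: memv_suml => k _; apply: IR; rewrite ?memvf // IL ?memvf.
Qed.

Lemma block_kernel_ideal j : two_sided_ideal (lker (amulr (e j))).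
Proof.
apply/andP; split; apply/prodvP => a b;
  rewrite !memv_lker_amulr => /eqP ae /eqP be; apply/eqP.
  by rewrite -mulrA be mulr0.
by rewrite -mulrA block_unitC mulrA ae mul0r.
Qed.

(** The [e j] sum to 1, so a proper ideal misses some [e j]; then its elements have no component in
    that block, and maximality gives equality. *)
Lemma maximal_idealP (I : {vspace A}) :
  maximal_ideal I <-> exists j, I = lker (amulr (e j)).
Proof.
split=> [[idI nfI maxI]|[j ->]].
  have [j ejI|eI] := pickP (fun j => e j \notin I); last first.
    case/eqP: nfI; apply: ideal_eq_fullv => //.
    by rewrite -sum_block_units memv_suml // => j _; apply/negbFE/eI.
  exists j; have sub : (I <= lker (amulr (e j)))%VS.
    apply/subvP => a Ia; rewrite memv_lker_amulr; apply: contraNT ejI.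
    exact: block_unit_ideal idI Ia.
  have [//|kerT] := maxI _ (block_kernel_ideal j) sub.
  have : e j \in lker (amulr (e j)) by rewrite kerT memvf.
  by rewrite memv_lker_amulr block_unitM eqxx (negPf (block_unit_neq0 j)).
split; first exact: block_kernel_ideal.
  apply: contraNneq (block_unit_neq0 j) => kerT.
  have : e j \in lker (amulr (e j)) by rewrite kerT memvf.
  by rewrite memv_lker_amulr block_unitM eqxx.
move=> J idJ sub; have [JI|/subvPn[a Ja]] := boolP (J <= lker (amulr (e j)))%VS.
  by left; apply/eqP; rewrite eqEsubv JI.
rewrite memv_lker_amulr => /(block_unit_ideal idJ Ja) Jej.
(* [J] contains [e j], and [1 - e j] lies in the kernel, which [J] contains. *)
right; apply: ideal_eq_fullv => //; rewrite -[1](subrK (e j)) memvD //.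
apply: (subvP sub); rewrite memv_lker_amulr.
by rewrite mulrBl mul1r block_unitM eqxx subrr.
Qed.

End BlockUnits.

(** * Linked blocks and normality of the subalgebra *)

Section Inclusion.
Variables (K : fieldType) (A : falgType K) (B : {aspace A}) (B1 : 1 \in B).
Variables (r s : nat).
Variables (W : 'I_r -> lmodType (subvs_of B)) (V : 'I_s -> lmodType A).
Variables (e : 'I_s -> A) (f : 'I_r -> subvs_of B).
Hypotheses (simV : forall j, simple_module (V j)).
Hypotheses (simW : forall i, simple_module (W i)).
Hypotheses (eV : block_units V e) (fW : block_units W f).

(* The vertices [i] and [j] are adjacent in the Bratteli diagram. *)
Definition linked (i : 'I_r) (j : 'I_s) : bool := vsval (f i) * e j != 0.

Lemma linked_multiplicity (M : 'M[nat]_(r, s)) i j :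
  inclusion_matrix B1 W V M -> linked i j = (0 < M i j)%N.
Proof.
move=> /(_ j)[h h_bij]; apply/idP/idP => [|Mij].
  apply: contraNT; rewrite -leqNgt leqn0 => /eqP Mij0; apply/eqP.
  apply/(mul_block_unit_eq0 eV) => v; have [g _ gK] := h_bij.
  rewrite -[v]gK scaler_sumr big1 // => l _; rewrite scaler_sumr big1 // => k _.
  (* [f i] acts within each copy of [W l]: as zero for [l] different from [i], while for [l = i]
     there is no copy. *)
  have -> : vsval (f i) *: (h l k (g v l k) : V j) = h l k (f i *: g v l k).
    by rewrite linearZ.
  rewrite (block_unit_scale fW); case: eqP k => [<- k|_ k]; last first.
    by rewrite linear0.
  by have := ltn_ord k; rewrite {2}Mij0.
apply/negP => /eqP/(mul_block_unit_eq0 eV) fV.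
have [[w /eqP w0] _] := simW i; apply: w0.
(* [z] has [w] in the first copy of [W i] and zero elsewhere. As [f i] fixes [w] but kills [V j],
   the image of [z] is zero, so injectivity forces [w = 0]. *)
pose z : {dffun forall l : 'I_r, {ffun 'I_(M l j) -> W l}} :=
  finfun (dfwith (fun l => [ffun => 0])
    [ffun k => if k == Ordinal Mij then w else 0]).
have hw k : h i k w = 0.
  have -> : w = f i *: w by rewrite (block_unit_scale fW) eqxx.
  by rewrite linearZ; apply: fV.
have : z = finfun (fun l => [ffun => 0]).
  apply: (bij_inj h_bij) => /=; apply: eq_bigr => l _; apply: eq_bigr => k _.
  rewrite !ffunE linear0; have [il|il] := eqVneq i l; last first.
    by rewrite dfwith_out // ffunE linear0.
  by case: l / il k => k; rewrite dfwith_in ffunE; case: eqP;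
    rewrite ?linear0 ?hw.
move=> /ffunP/(_ i); rewrite !ffunE dfwith_in => /ffunP/(_ (Ordinal Mij)).
by rewrite !ffunE eqxx.
Qed.

Lemma mem_vsval a : a \in B -> exists b : subvs_of B, a = vsval b.
Proof. by move=> Ba; exists (vsproj B a); rewrite vsprojK. Qed.

Lemma vsvalM (b c : subvs_of B) : vsval (b * c) = vsval b * vsval c.
Proof. by []. Qed.

(** Were [b * f i] nonzero, simplicity of the block would write [f i] as a sum of products through
    [b]; as [e j] is central, [f i * e j] would vanish with [b * e j]. *)
Lemma mul_linkedN i j (b : subvs_of B) :
  linked i j -> vsval b * e j = 0 -> b * f i = 0.
Proof.
move=> + be0; apply: contraNeq => /(block_unit_span fW)[m [x [y ->]]].
rewrite raddf_sum mulr_suml big1 // => k _.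
rewrite /= ?vsvalM -mulrA (block_unitC eV) mulrA -(mulrA (vsval (x k))) be0.
by rewrite mulr0 mul0r.
Qed.

(** If [f i] killed [V j], the two-sided ideal [I * fullv] would contain [f i], hence [e k]. But
    [f l] annihilates this ideal from the left, forcing [f l * e k = 0]. *)
Lemma linked_of_normal i l k j : normal_subalgebra B ->
  linked i k -> linked l k -> linked l j -> linked i j.
Proof.
move=> nB ik lk lj; apply: contraTT lk => /negPn/eqP ij0; apply/negPn/eqP.
pose I := (lker (amulr (e j)) :&: B)%VS.
have nI : (I * fullv = fullv * I)%VS.
  by apply/nB/(maximal_idealP simV eV); exists j.
(* Normality is what makes this right ideal stable under left multiplication. *)
have idI : two_sided_ideal (I * fullv).
  apply/andP; split; last by rewrite -prodvA prodvSr ?subvf.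
  by rewrite nI prodvA prodvSl ?subvf.
have fI : vsval (f i) \in (I * fullv)%VS.
  rewrite -[vsval _]mulr1 memv_mul ?memvf // memv_cap subvsP.
  by rewrite memv_lker_amulr ij0 eqxx.
have ekI := block_unit_ideal eV idI fI ik.
have /subvP/(_ _ ekI) : (I * fullv <= lker (amull (vsval (f l))))%VS.
  apply/prodvP => b a; rewrite memv_cap memv_lker_amulr.
  move=> /andP[/eqP be /mem_vsval[c bc]] _.
  rewrite memv_ker lfunE /= mulrA bc -vsvalM -(block_unitC fW).
  by rewrite (mul_linkedN lj) ?mul0r // -bc.
by rewrite memv_ker lfunE => /eqP.
Qed.

Lemma normal_of_linked :
  (forall i l k j, linked i k -> linked l k -> linked l j -> linked i j) ->
  normal_subalgebra B.
Proof.
move=> link I /(maximal_idealP simV eV)[j ->{I}].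
pose g := \sum_(i | ~~ linked i j) f i.
(* Blocks linked to [j] contribute nothing to [b], so [g] is the identity of the annihilator of
   [V j] in [B]. *)
have gB b : vsval b * e j = 0 -> b = b * g.
  move=> be; rewrite -[LHS]mulr1 -(sum_block_units fW) (bigID (linked^~ j)) /=.
  rewrite mulrDr mulr_sumr big1 ?add0r // => i ij.
  exact: mul_linkedN be.
have gC a : a * vsval g = vsval g * a.
  apply: (eq_block_units eV) => k.
  (* If columns [k] and [j] meet, the support of [k] lies in that of [j] and [g] is 0 on block [k];
     otherwise [g] is 1 there. *)
  have [l /andP[lk lj]|nlk] := pickP (fun l => linked l k && linked l j).
    have ge0 : vsval g * e k = 0.
      rewrite raddf_sum mulr_suml big1 //= => i; apply: contraNeq => ik.
      exact: link ik lk lj.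
    by rewrite -mulrA ge0 mulr0 -mulrA (block_unitC eV) mulrA ge0 mul0r.
  suff ge : vsval g * e k = e k.
    by rewrite -mulrA ge -mulrA (block_unitC eV k a) mulrA ge.
  have vsval1 : vsval (1 : subvs_of B) = 1 by apply/eqP; rewrite /= algid_eq1.
  rewrite -[RHS]mul1r -vsval1 -(sum_block_units fW).
  rewrite [in RHS](bigID (linked^~ j)) /= mulrDl.
  rewrite [X in _ = X + _](_ : _ = 0) ?add0r // raddf_sum mulr_suml.
  rewrite big1 //= => i ij; apply/eqP/negPn.
  by have := nlk i; rewrite ij andbT => /negbT.
have gI : vsval g \in (lker (amulr (e j)) :&: B)%VS.
  rewrite memv_cap subvsP andbT memv_lker_amulr raddf_sum mulr_suml.
  by rewrite big1 //= => i /negPn/eqP.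
(* A factor [g] is split off the element of the intersection and moved by centrality to the other
   end of the product. *)
apply/eqP; rewrite eqEsubv; apply/andP; split; apply/prodvP => x y.
  rewrite memv_cap memv_lker_amulr => /andP[/eqP xe /mem_vsval[b xb]] _.
  rewrite xb in xe *; rewrite (gB _ xe) vsvalM -mulrA -gC mulrA.
  by rewrite memv_mul ?memvf.
rewrite memv_cap memv_lker_amulr => _ /andP[/eqP ye /mem_vsval[b yb]].
rewrite yb in ye *; rewrite (gB _ ye) vsvalM mulrA gC.
by rewrite memv_mul ?memvf.
Qed.

End Inclusion.

(** * The depth 2 inequality in terms of supports *)

Lemma depth2_inequalityP (r s : nat) (M : 'M[nat]_(r, s)) :
  is_depth M 2 <->
  forall i l k j, (0 < M i k -> 0 < M l k -> 0 < M l j -> 0 < M i j)%N.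
Proof.
pose N := M *m (M^T *m M).
have altpow3 : altpow M 3 = N by rewrite /= mulmx1 trmxK.
have altpow1 : altpow M 1 = M by rewrite /= mulmx1.
(* A positive entry of [N] is a walk of length three from [i] through [k] and [l] to [j] in the
   Bratteli diagram. *)
have N_gt0 i j : (0 < N i j)%N <->
    exists k l, [&& 0 < M i k, 0 < M l k & 0 < M l j]%N.
  rewrite lt0n !mxE sum_nat_eq0 negb_forall; split.
    move=> /existsP[k]; rewrite /= muln_eq0 negb_or !mxE.
    move=> /andP[ik]; rewrite sum_nat_eq0 negb_forall => /existsP[l].
    rewrite /= muln_eq0 negb_or mxE => /andP[lk lj].
    by exists k, l; rewrite !lt0n ik lk.
  move=> [k [l]]; rewrite !lt0n => /and3P[ik lk lj].
  apply/existsP; exists k; rewrite /= muln_eq0 negb_or ik /=.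
  rewrite mxE sum_nat_eq0 negb_forall; apply/existsP; exists l.
  by rewrite /= muln_eq0 negb_or mxE lk.
split=> [[_ [q _ Mq] _] i l k j ik lk lj|MM].
  have Nij : (0 < N i j)%N by apply/N_gt0; exists k, l; rewrite ik lk.
  have := leq_trans Nij; rewrite -altpow3 => /(_ _ (Mq i j)).
  by rewrite altpow1 muln_gt0 => /andP[].
(* This constant exceeds every entry of [N], so it suffices that [M i j] is positive wherever
   [N i j] is; the successor keeps it positive when [N] vanishes. *)
split=> //; exists (\sum_i \sum_j N i j).+1 => // i j.
have := altpow3; rewrite /width => ->; rewrite altpow1.
have [->//|Nij] := posnP (N i j).
have /N_gt0[k [l /and3P[ik lk lj]]] := Nij.
rewrite mulSn (leq_trans _ (leq_addl _ _)) //.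
rewrite (leq_trans _ (leq_pmulr _ (MM _ _ _ _ ik lk lj))) //.
by rewrite (bigD1 i) //= (bigD1 j) //= -addnA leq_addr.
Qed.

(** [multimatrix] provides full matrix blocks over [K] itself, so the argument runs over any field;
    the complex case is an instance. *)
Theorem multimatrix_depth2_normal (K : fieldType) (A : falgType K)
    (B : {aspace A})
    (hA : multimatrix A) (hB : multimatrix (subvs_of B)) (B1 : 1 \in B)
    (r s : nat) (W : 'I_r -> lmodType (subvs_of B)) (V : 'I_s -> lmodType A)
    (hW : simple_modules W) (hV : simple_modules V)
    (M : 'M[nat]_(r, s)) (hM : inclusion_matrix B1 W V M) :
  is_depth M 2 <-> normal_subalgebra B.
Proof.
have [[e eV] [f fW]] := (exists_block_units hA hV, exists_block_units hB hW).
have [simV _ _] := hV; have [simW _ _] := hW.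
have link i j := linked_multiplicity simW eV fW i j hM.
apply: iff_trans (depth2_inequalityP M) _; split=> [MM|nB i l k j].
  by apply: (normal_of_linked B1 simV eV fW) => i l k j;
    rewrite !link; apply: MM.
by rewrite -!link; exact: (linked_of_normal simV eV fW).
Qed.

Local Open Scope complex_scope.

Theorem theorem4p6 (R : realType) (A : falgType R[i]) (B : {aspace A})
    (hA : multimatrix A) (hB : multimatrix (subvs_of B)) (B1 : 1 \in B)
    (r s : nat) (W : 'I_r -> lmodType (subvs_of B)) (V : 'I_s -> lmodType A)
    (hW : simple_modules W) (hV : simple_modules V)
    (M : 'M[nat]_(r, s)) (hM : inclusion_matrix B1 W V M) :
  is_depth M 2 <-> normal_subalgebra B.
Proof. exact: (multimatrix_depth2_normal hA hB hW hV hM). Qed.
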